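(* The quaternionic Hadamard matrix $$M=\begin{bmatrix}1&q\mathbf i&1&-\mathbf j&-\mathbf j\\ -\mathbf j&1&q\mathbf i&1&-\mathbf j\\ -\mathbf j&-\mathbf j&1&q\mathbf i&1\\ 1&-\mathbf j&-\mathbf j&1&q\mathbf i\\ q\mathbf i&1&-\mathbf j&-\mathbf j&1\end{bmatrix}$$ is not equivalent to the quaternionic Hadamard matrix $G(\mathbf i,\ \mathbf i e^{\frac{2\pi}{3}\mathbf j},\ \mathbf i e^{\frac{4\pi}{3}\mathbf j})$, where $$G(a,b,c)=\begin{bmatrix}1&1&1&1&1\\ 1&-1&a&b&c\\ 1&a&-1&c&b\\ 1&b&c&-1&a\\ 1&c&b&a&-1\end{bmatrix}.$$
   Context: $\mathbb H$ is the real algebra of quaternions with basic units $\mathbf i,\mathbf j,\mathbf k$ ($\mathbf i\mathbf j=\mathbf k=-\mathbf j\mathbf i$, squares equal to $-1$); $q=(1+\mathbf i+\mathbf j+\mathbf k)/2$. For a quaternion $w$ with $w^2=-1$ and $t\in\mathbb R$, $e^{wt}=\cos t+w\sin t$. A quaternionic Hadamard matrix (QHM) of order $n$ is an $n\times n$ matrix $G$ with unit-norm quaternion entries such that $GG^*=nI_n$, where $G^*$ is the conjugate transpose. Two QHMs are equivalent if one can be obtained from the other by multiplying rows on the left by unit quaternions, multiplying columns on the right by unit quaternions, interchanging rows, or interchanging columns. *)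

(* Defs.v *)
From HB Require Import structures.
From mathcomp Require Import all_boot all_order all_algebra.
From mathcomp Require Import ring.
From mathcomp Require Import reals trigo.

Set Implicit Arguments.
Unset Strict Implicit.
Unset Printing Implicit Defensive.

Import Order.TTheory GRing.Theory Num.Theory.
Local Open Scope ring_scope.

(* Quat a b c d stands for a + b i + c j + d k *)
Record quat (R : Type) := Quat { qre : R; qim_i : R; qim_j : R; qim_k : R }.

Section Encoding.
Variable R : Type.

Definition tuple_of_quat (x : quat R) : R * R * R * R :=
  (qre x, qim_i x, qim_j x, qim_k x).
Definition quat_of_tuple (t : R * R * R * R) : quat R :=
  Quat t.1.1.1 t.1.1.2 t.1.2 t.2.

Lemma tuple_of_quatK : cancel tuple_of_quat quat_of_tuple.
Proof. by case. Qed.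

End Encoding.

HB.instance Definition _ (R : eqType) :=
  Equality.copy (quat R) (can_type (@tuple_of_quatK R)).
HB.instance Definition _ (R : choiceType) :=
  Choice.copy (quat R) (can_type (@tuple_of_quatK R)).

Section Algebra.
Variable R : comNzRingType.
Implicit Types x y z : quat R.

Definition addq x y :=
  Quat (qre x + qre y) (qim_i x + qim_i y) (qim_j x + qim_j y)
       (qim_k x + qim_k y).
Definition oppq x := Quat (- qre x) (- qim_i x) (- qim_j x) (- qim_k x).
Definition zeroq : quat R := Quat 0 0 0 0.
Definition oneq : quat R := Quat 1 0 0 0.
Definition mulq x y :=
  let: Quat a b c d := x in let: Quat a' b' c' d' := y in
  Quat (a * a' - b * b' - c * c' - d * d')
       (a * b' + b * a' + c * d' - d * c')
       (a * c' - b * d' + c * a' + d * b')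
       (a * d' + b * c' - c * b' + d * a').
Definition scaleq (r : R) x :=
  Quat (r * qre x) (r * qim_i x) (r * qim_j x) (r * qim_k x).

Fact addqA : associative addq.
Proof. by move=> x y z; rewrite /addq /= !addrA. Qed.
Fact addqC : commutative addq.
Proof. by move=> x y; congr Quat; rewrite addrC. Qed.
Fact add0q : left_id zeroq addq.
Proof. by case=> a b c d; rewrite /addq /= !add0r. Qed.
Fact addNq : left_inverse zeroq oppq addq.
Proof. by move=> x; rewrite /addq /= !addNr. Qed.

HB.instance Definition _ :=
  GRing.isZmodule.Build (quat R) addqA addqC add0q addNq.

Fact mulqA : associative mulq.
Proof.
by case=> a b c d [a' b' c' d'] [a'' b'' c'' d'']; congr Quat; ring.
Qed.
Fact mul1q : left_id oneq mulq.
Proof. by case=> a b c d; congr Quat; ring. Qed.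
Fact mulq1 : right_id oneq mulq.
Proof. by case=> a b c d; congr Quat; ring. Qed.
Fact mulqDl : left_distributive mulq +%R.
Proof.
by case=> a b c d [a' b' c' d'] [a'' b'' c'' d'']; congr Quat => /=; ring.
Qed.
Fact mulqDr : right_distributive mulq +%R.
Proof.
by case=> a b c d [a' b' c' d'] [a'' b'' c'' d'']; congr Quat => /=; ring.
Qed.
Fact oneq_neq0 : oneq != 0.
Proof. by apply/eqP => -[/eqP]; rewrite oner_eq0. Qed.

HB.instance Definition _ := GRing.Zmodule_isNzRing.Build (quat R)
  mulqA mul1q mulq1 mulqDl mulqDr oneq_neq0.

Fact scaleqA r s x : scaleq r (scaleq s x) = scaleq (r * s) x.
Proof. by rewrite /scaleq /= !mulrA. Qed.
Fact scale1q : left_id 1 scaleq.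
Proof. by case=> a b c d; rewrite /scaleq /= !mul1r. Qed.
Fact scaleqDr : right_distributive scaleq +%R.
Proof. by move=> r x y; congr Quat; rewrite mulrDr. Qed.
Fact scaleqDl x : {morph scaleq^~ x : r s / r + s}.
Proof. by move=> r s; congr Quat; rewrite mulrDl. Qed.

HB.instance Definition _ := GRing.Zmodule_isLmodule.Build R (quat R)
  scaleqA scale1q scaleqDr scaleqDl.

Fact scaleqAl (r : R) x y : r *: (x * y) = (r *: x) * y.
Proof. by case: x y => a b c d [a' b' c' d']; congr Quat => /=; ring. Qed.
Fact scaleqAr (r : R) x y : r *: (x * y) = x * (r *: y).
Proof. by case: x y => a b c d [a' b' c' d']; congr Quat => /=; ring. Qed.

HB.instance Definition _ := GRing.Lmodule_isLalgebra.Build R (quat R) scaleqAl.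
HB.instance Definition _ := GRing.Lalgebra_isAlgebra.Build R (quat R) scaleqAr.

Definition qi : quat R := Quat 0 1 0 0.
Definition qj : quat R := Quat 0 0 1 0.
Definition qk : quat R := Quat 0 0 0 1.

Lemma qi_sqr : qi * qi = -1. Proof. by congr Quat => /=; ring. Qed.
Lemma qj_sqr : qj * qj = -1. Proof. by congr Quat => /=; ring. Qed.
Lemma qk_sqr : qk * qk = -1. Proof. by congr Quat => /=; ring. Qed.
Lemma mul_qi_qj : qi * qj = qk. Proof. by congr Quat => /=; ring. Qed.
Lemma mul_qj_qi : qj * qi = - qk. Proof. by congr Quat => /=; ring. Qed.

Definition conjq x := Quat (qre x) (- qim_i x) (- qim_j x) (- qim_k x).

Definition adjq m n (A : 'M[quat R]_(m, n)) : 'M[quat R]_(n, m) :=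
  map_mx conjq A^T.

End Algebra.

Definition qnorm (R : rcfType) (x : quat R) : R :=
  Num.sqrt (qre x ^+ 2 + qim_i x ^+ 2 + qim_j x ^+ 2 + qim_k x ^+ 2).

Definition is_QHM (R : rcfType) n (A : 'M[quat R]_n) : Prop :=
  (forall i j, qnorm (A i j) = 1) /\ A *m adjq A = n%:R%:M.

Section Equivalence.
Variables (R : rcfType) (n : nat).

Definition scale_row (r : 'I_n) (u : quat R) (A : 'M[quat R]_n) :=
  \matrix_(i, j) (if i == r then u * A i j else A i j).
Definition scale_col (s : 'I_n) (u : quat R) (A : 'M[quat R]_n) :=
  \matrix_(i, j) (if j == s then A i j * u else A i j).

(* B is obtained from A by finitely many elementary operations; each of them
   is undone by an operation of the same kind. *)
Inductive qequiv (A : 'M[quat R]_n) : 'M[quat R]_n -> Prop :=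
| qequiv_refl : qequiv A A
| qequiv_scale_row B r u :
    qequiv A B -> qnorm u = 1 -> qequiv A (scale_row r u B)
| qequiv_scale_col B s u :
    qequiv A B -> qnorm u = 1 -> qequiv A (scale_col s u B)
| qequiv_xrow B r r' : qequiv A B -> qequiv A (xrow r r' B)
| qequiv_xcol B s s' : qequiv A B -> qequiv A (xcol s s' B).

End Equivalence.

Definition matrix_of_rows (T : nmodType) n (rows : seq (seq T)) : 'M[T]_n :=
  \matrix_(i, j) nth 0 (nth [::] rows i) j.

Section Matrices.
Variable R : realType.

(* exponential e^(w t), meant for w with w * w = -1 *)
Definition qexp (w : quat R) (t : R) : quat R := (cos t)%:A + sin t *: w.

Definition qq : quat R := 2^-1 *: (1 + qi R + qj R + qk R).

Definition matM : 'M[quat R]_5 :=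
  let a := qq * qi R in let b := - qj R in
  matrix_of_rows 5
    [:: [:: 1; a; 1; b; b];
        [:: b; 1; a; 1; b];
        [:: b; b; 1; a; 1];
        [:: 1; b; b; 1; a];
        [:: a; 1; b; b; 1]].

Definition matG (a b c : quat R) : 'M[quat R]_5 :=
  matrix_of_rows 5
    [:: [:: 1;  1;  1;  1;  1];
        [:: 1; -1;  a;  b;  c];
        [:: 1;  a; -1;  c;  b];
        [:: 1;  b;  c; -1;  a];
        [:: 1;  c;  b;  a; -1]].

End Matrices.

(* Main.v *)
(* The real part of the cross ratio A_ij conj(A_kj) A_kl conj(A_il) of four unit
   entries is unchanged when rows are scaled on the left and columns on the
   right, and permutations only rename its indices.  So the set of its values
   is an invariant of equivalence: M attains 1/2, whereas the values attained
   by G are 0, 1, -1 and -1/2.  Since the entries of 2 G are a + b i + c j + d k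
   with a, b, c/sqrt 3, d/sqrt 3 integers, a range stable under products, the
   latter is a finite computation over the integers. *)
Require Import Defs.
From mathcomp Require Import all_boot all_order all_algebra perm.
From mathcomp Require Import ring lra.
From mathcomp Require Import reals trigo.

Set Implicit Arguments.
Unset Strict Implicit.

Import GRing.Theory Num.Theory.
Local Open Scope ring_scope.

Lemma conjqM (R : comNzRingType) (x y : quat R) :
  conjq (x * y) = conjq y * conjq x.
Proof. by case: x y => a b c d [a' b' c' d']; congr Quat => /=; ring. Qed.

Lemma qre_mulC (R : comNzRingType) (x y : quat R) : qre (x * y) = qre (y * x).
Proof. by case: x y => a b c d [a' b' c' d'] /=; ring. Qed.

Lemma qnorm1E (R : rcfType) (x : quat R) :
  (qnorm x = 1) <->
  (qre x ^+ 2 + qim_i x ^+ 2 + qim_j x ^+ 2 + qim_k x ^+ 2 = 1).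
Proof.
rewrite /qnorm; move: (qre x) (qim_i x) (qim_j x) (qim_k x) => a b c d.
have t0 : 0 <= a ^+ 2 + b ^+ 2 + c ^+ 2 + d ^+ 2 by rewrite !addr_ge0 ?sqr_ge0.
by split=> [h | ->]; [rewrite -(sqr_sqrtr t0) h expr1n | rewrite sqrtr1].
Qed.

Lemma qnorm1_mulVq (R : rcfType) (u : quat R) : qnorm u = 1 -> conjq u * u = 1.
Proof.
by move/qnorm1E; case: u => a b c d /= h; congr Quat => /=; rewrite -?h; ring.
Qed.

Lemma qnorm1_mulqV (R : rcfType) (u : quat R) : qnorm u = 1 -> u * conjq u = 1.
Proof.
by move/qnorm1E; case: u => a b c d /= h; congr Quat => /=; rewrite -?h; ring.
Qed.

Lemma qnorm1_1 (R : rcfType) : qnorm (1 : quat R) = 1.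
Proof. by apply/qnorm1E => /=; ring. Qed.

Section CrossRatio.
Variables (R : rcfType) (n : nat).
Implicit Types (A B : 'M[quat R]_n) (i j k l : 'I_n).

Definition re_cross A i j k l :=
  qre (A i j * conjq (A k j) * A k l * conjq (A i l)).

(** The alternating conjugates place [v j], [u k] and [v l] next to their own conjugates, where they
    cancel. The outer pair [u i], [conjq (u i)] cancels because the real part of a product is
    invariant under cyclic rotation. *)
Lemma re_cross_scale A (u v : 'I_n -> quat R) i j k l :
    (forall i, qnorm (u i) = 1) -> (forall j, qnorm (v j) = 1) ->
  re_cross (\matrix_(i, j) (u i * A i j * v j)) i j k l = re_cross A i j k l.
Proof.
move=> u1 v1; rewrite /re_cross !mxE !conjqM !mulrA.
rewrite qre_mulC !mulrA qnorm1_mulVq // mul1r.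
rewrite -(mulrA _ _ (conjq (v j))) qnorm1_mulqV // mulr1.
rewrite -(mulrA _ _ (u k)) qnorm1_mulVq // mulr1.
by rewrite -(mulrA _ _ (conjq (v l))) qnorm1_mulqV // mulr1.
Qed.

Lemma qequiv_re_cross A B : qequiv A B -> forall i j k l,
  exists i' j' k' l', re_cross B i' j' k' l' = re_cross A i j k l.
Proof.
move=> AB i j k l.
elim: AB => [|{}B r u _ [i' [j' [k' [l' <-]]]] u1|{}B s u _ [i' [j' [k' [l' <-]]]] u1
  |{}B r r' _ [i' [j' [k' [l' <-]]]]|{}B s s' _ [i' [j' [k' [l' <-]]]]].
- by exists i, j, k, l.
- exists i', j', k', l'.
  pose w i0 := if i0 == r then u else 1.
  have -> : scale_row r u B = \matrix_(i, j) (w i * B i j * 1).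
    by apply/matrixP => p q; rewrite !mxE mulr1 /w; case: eqP; rewrite ?mul1r.
  rewrite (@re_cross_scale B w (fun=> 1)) // => p; rewrite ?qnorm1_1 //.
  by rewrite /w; case: eqP; rewrite ?qnorm1_1.
- exists i', j', k', l'.
  pose w j0 := if j0 == s then u else 1.
  have -> : scale_col s u B = \matrix_(i, j) (1 * B i j * w j).
    by apply/matrixP => p q; rewrite !mxE mul1r /w; case: eqP; rewrite ?mulr1.
  rewrite (@re_cross_scale B (fun=> 1) w) // => p; rewrite ?qnorm1_1 //.
  by rewrite /w; case: eqP; rewrite ?qnorm1_1.
(* A transposition is an involution, so the swapped matrix at the swapped indices returns the
   original entries. *)
- exists (tperm r r' i'), j', (tperm r r' k'), l'.
  by rewrite /re_cross !mxE !tpermK.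
- exists i', (tperm s s' j'), k', (tperm s s' l').
  by rewrite /re_cross !mxE !tpermK.
Qed.

End CrossRatio.

(** Splits into five literal indices, at which the entries of a matrix given by its rows compute. *)
Lemma ord5P (P : 'I_5 -> Prop) :
  P (@Ordinal 5 0 isT) -> P (@Ordinal 5 1 isT) -> P (@Ordinal 5 2 isT) ->
  P (@Ordinal 5 3 isT) -> P (@Ordinal 5 4 isT) -> forall i, P i.
Proof.
move=> p0 p1 p2 p3 p4 [[|[|[|[|[|//]]]]] lti];
by rewrite (bool_irrelevance lti isT).
Qed.

Lemma is_QHM_matM (R : realType) : is_QHM (matM R).
Proof.
split.
  by apply: ord5P; apply: ord5P; apply/qnorm1E; rewrite mxE /=; field.
by apply/matrixP; apply: ord5P; apply: ord5P;
  rewrite !mxE !big_ord_recl big_ord0 !mxE; congr Quat; rewrite /=; field.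
Qed.

Section SqrtThree.
Variables (R : realType) (s : R).
Hypothesis s2 : s ^+ 2 = 3.

Definition twist (x : quat int) : quat R :=
  Quat (qre x)%:~R (qim_i x)%:~R ((qim_j x)%:~R * s) ((qim_k x)%:~R * s).

(* The quaternion product read on the coordinates (a, b, c/s, d/s). *)
Definition mul3 (x y : quat int) : quat int :=
  let: Quat a b c d := x in let: Quat a' b' c' d' := y in
  Quat (a * a' - b * b' - 3 * (c * c') - 3 * (d * d'))
       (a * b' + b * a' + 3 * (c * d') - 3 * (d * c'))
       (a * c' - b * d' + c * a' + d * b')
       (a * d' + b * c' - c * b' + d * a').

Lemma twistM x y : twist (mul3 x y) = twist x * twist y.
Proof.
case: x y => a b c d [a' b' c' d']; rewrite /twist.
have h (u v : R) : 3 * (u * v) = u * s * (v * s) by rewrite -s2; ring.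
by congr Quat; rewrite /= ?(rmorphD, rmorphN, rmorphM) /= ?h; ring.
Qed.

Lemma conjq_twist x : conjq (twist x) = twist (conjq x).
Proof. by case: x => a b c d; rewrite /conjq /twist /= !rmorphN !mulNr. Qed.

(** Doubling clears the denominators of the entries with coordinates [- 2^-1] and [s / 2]; in
    [twist] coordinates these become -1 and 1. *)
Definition tableG : seq (seq (quat int)) :=
  let o := Quat 2 0 0 0 in let m := Quat (- 2) 0 0 0 in
  let a := Quat 0 2 0 0 in
  let b := Quat 0 (- 1) 0 1 in let c := Quat 0 (- 1) 0 (- 1) in
  [:: [:: o; o; o; o; o];
      [:: o; m; a; b; c];
      [:: o; a; m; c; b];
      [:: o; b; c; m; a];
      [:: o; c; b; a; m]].

Definition entryG i j := nth (0 : quat int) (nth [::] tableG i) j.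

Definition matG3 : 'M[quat R]_5 :=
  matG (qi R) (Quat 0 (- 2^-1) 0 (s / 2)) (Quat 0 (- 2^-1) 0 (- (s / 2))).

Lemma matG3E i j : matG3 i j = 2^-1 *: twist (entryG i j).
Proof.
by move: i j; apply: ord5P; apply: ord5P; rewrite mxE; congr Quat => /=; field.
Qed.

Definition crossG i j k l :=
  qre (mul3 (mul3 (mul3 (entryG i j) (conjq (entryG k j))) (entryG k l))
            (conjq (entryG i l))).

Lemma conjqZ (a : R) x : conjq (a *: x) = a *: conjq x.
Proof. by case: x => *; congr Quat => /=; ring. Qed.

(** Each of the four factors contributes [2^-1], whence the 16. *)
Lemma re_cross_matG3 i j k l :
  re_cross matG3 i j k l = (crossG i j k l)%:~R / 16.
Proof.
rewrite /re_cross !matG3E !conjqZ !conjq_twist.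
rewrite -!(scalerAl, scalerAr) -!twistM /=; by field.
Qed.

(* 2 G has integral coordinates, so the cross ratio 1/2 becomes 16 * 1/2. *)
Lemma crossG_neq8 (i j k l : 'I_5) : crossG i j k l != 8.
Proof.
(* As a boolean over natural number indices, all 625 cases are decided by one evaluation. *)
have /allP all8 : all (fun i => all (fun j => all (fun k => all (fun l =>
  crossG i j k l != 8) (iota 0 5)) (iota 0 5)) (iota 0 5)) (iota 0 5).
  by vm_compute.
have ord5_iota (m : 'I_5) : val m \in iota 0 5 by rewrite mem_iota /= ltn_ord.
have /allP all8_i := all8 _ (ord5_iota i).
have /allP all8_ij := all8_i _ (ord5_iota j).
have /allP all8_ijk := all8_ij _ (ord5_iota k).
exact: all8_ijk (ord5_iota l).
Qed.

Lemma is_QHM_matG3 : is_QHM matG3.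
Proof.
have t2 : (s / 2) ^+ 2 = 3 / 4 by rewrite expr_div_n s2; field.
(* With [t] opaque, every goal is linear in [t] and [t ^+ 2], within reach of [lra]. *)
rewrite /matG3; move: (s / 2) t2 => t t2; split.
  by apply: ord5P; apply: ord5P; apply/qnorm1E; rewrite mxE /=; lra.
by apply/matrixP; apply: ord5P; apply: ord5P;
  rewrite !mxE !big_ord_recl big_ord0 !mxE; congr Quat; rewrite /=; lra.
Qed.

End SqrtThree.

Lemma trig_2pi3 (R : realType) :
  cos (2 * pi / 3 : R) = - 2^-1 /\ sin (2 * pi / 3 : R) ^+ 2 = 3 / 4.
Proof.
set t := 2 * pi / 3.
have st : 0 < sin t.
  by apply: sin_gt0_pi; have := pi_gt0 R; rewrite /t => p; apply/andP; split; lra.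
have h : t *+ 2 = pi *+ 2 - t by rewrite /t; field.
have := congr1 cos h; rewrite cos_mulr2n cosB cos2pi sin2pi => c2.
have cs := sin2cos2 t.
(* Since [2 t = 2 pi - t], the double angle formula gives a quadratic equation for [cos t]; the root
   1 would force [sin t = 0]. *)
have /eqP : (2 * cos t + 1) * (cos t - 1) = 0 by lra.
rewrite mulf_eq0 => /orP[] /eqP ct; last first.
  by have := exprn_gt0 2 st; rewrite cs (subr0_eq ct); lra.
have {}ct : cos t = - 2^-1 by lra.
by rewrite cs ct; split=> //; field.
Qed.

Lemma trig_4pi3 (R : realType) :
  cos (4 * pi / 3 : R) = cos (2 * pi / 3 : R) /\
  sin (4 * pi / 3 : R) = - sin (2 * pi / 3 : R).
Proof.
have -> : (4 * pi / 3 : R) = pi *+ 2 - 2 * pi / 3 by field.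
by rewrite cosB sinB cos2pi sin2pi; split; ring.
Qed.

Lemma mul_qi_qexp_qj (R : realType) (t : R) :
  qi R * qexp (qj R) t = Quat 0 (cos t) 0 (sin t).
Proof. by congr Quat => /=; ring. Qed.

Theorem proposition21 (R : realType) :
  let G := matG (qi R) (qi R * qexp (qj R) (2 * pi / 3))
                (qi R * qexp (qj R) (4 * pi / 3)) in
  is_QHM (matM R) /\ is_QHM G /\ ~ qequiv (matM R) G.
Proof.
move=> G; have [c1 s1] := trig_2pi3 R; have [c2 s2] := trig_4pi3 R.
(* Only the square of [s] matters, so this serves directly as a square root of 3. *)
pose s : R := 2 * sin (2 * pi / 3).
have s3 : s ^+ 2 = 3 by rewrite /s exprMn s1; field.
have GE : G = matG3 s.
  rewrite /G /matG3 !mul_qi_qexp_qj c2 s2 c1.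
  by have -> : sin (2 * pi / 3) = s / 2 by rewrite /s; field.
split; first exact: is_QHM_matM.
rewrite GE; split; first exact: is_QHM_matG3.
move=> MG.
pose i1 := @Ordinal 5 1 isT.
(* The top left 2 by 2 block of [matM] gives the real part of [qj * conjq (qq * qi)], which is
   1/2. *)
have M1 : re_cross (matM R) ord0 ord0 i1 i1 = 2^-1.
  by rewrite /re_cross !mxE /=; field.
have [i [j [k [l]]]] := qequiv_re_cross MG ord0 ord0 i1 i1.
rewrite M1 re_cross_matG3 // => G1.
have : (crossG i j k l)%:~R = 8%:~R :> R by lra.
by move/intr_inj/eqP; apply/negP/crossG_neq8.
Qed.
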